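(* Let $R$ be a commutative ring with identity and let $S$ be a multiplicatively closed subset of $R$. Then every fully idempotent $R$-module is a fully $S$-idempotent $R$-module. Conversely, if $S \subseteq U(R)$, where $U(R)$ is the set of units of $R$, then every fully $S$-idempotent $R$-module is a fully idempotent $R$-module.
   Context: For a submodule $N$ of an $R$-module $M$, $(N:_R M)=\{r\in R : rM\subseteq N\}$. A submodule $N$ of $M$ is idempotent if $N=(N:_R M)^2M$; $M$ is fully idempotent if every submodule of $M$ is idempotent. A submodule $N$ of $M$ is an $S$-idempotent submodule if there exists $s\in S$ such that $sN\subseteq (N:_R M)^2M\subseteq N$; $M$ is fully $S$-idempotent if every submodule of $M$ is an $S$-idempotent submodule. *)

(* Defs.v *)
From HB Require Import structures.
From mathcomp Require Import all_boot all_order all_algebra.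
From mathcomp Require Import boolp classical_sets.

Set Implicit Arguments.
Unset Strict Implicit.
Unset Printing Implicit Defensive.

Import GRing.Theory.

Local Open Scope classical_set_scope.
Local Open Scope ring_scope.

(* Multiplicatively closed: 1 is in S and S is closed under products. The
   condition that 0 is not in S, which some authors add, is not required. *)
Definition mult_closed (R : comPzRingType) (S : set R) : Prop :=
  GRing.mulr_closed (mem S).

(* Stated for comPzRingType, without GRing.unit, so that the zero ring and
   rings with no canonical unitRingType structure are covered. *)
Definition units (R : comPzRingType) : set R :=
  [set r | exists r' : R, r' * r = 1].
Arguments units : clear implicits.

(* Submodules are arbitrary, possibly undecidable, subsets. *)
Definition submodule (R : comPzRingType) (M : lmodType R) (N : set M) : Prop :=
  GRing.submod_closed (mem N).

(* The residual (N :_R M). *)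
Definition colon (R : comPzRingType) (M : lmodType R) (N : set M) : set R :=
  [set r | [set r *: x | x in [set: M]] `<=` N].

(* I X is the set of finite sums of products a *: x with a in I and x in X;
   n = 0 gives the empty sum 0. *)
Definition smul (R : comPzRingType) (M : lmodType R) (I : set R) (X : set M) :
    set M :=
  [set y | exists (n : nat) (a : 'I_n -> R) (x : 'I_n -> M),
    (forall i, I (a i)) /\ (forall i, X (x i)) /\
    y = \sum_(i < n) a i *: x i].

(* The product of ideals: on the regular module R^o, *: is multiplication. *)
Definition ideal_mul (R : comPzRingType) (I J : set R) : set R :=
  smul (M := R^o) I J.

Definition colon_sqr_mul (R : comPzRingType) (M : lmodType R) (N : set M) :
    set M :=
  smul (ideal_mul (colon N) (colon N)) [set: M].

Definition idempotent_submodule (R : comPzRingType) (M : lmodType R)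
    (N : set M) : Prop :=
  N = colon_sqr_mul N.

Definition fully_idempotent (R : comPzRingType) (M : lmodType R) : Prop :=
  forall N : set M, submodule N -> idempotent_submodule N.

Definition S_idempotent_submodule (R : comPzRingType) (S : set R)
    (M : lmodType R) (N : set M) : Prop :=
  exists s : R, S s /\
    [set s *: x | x in N] `<=` colon_sqr_mul N /\ colon_sqr_mul N `<=` N.

Definition fully_S_idempotent (R : comPzRingType) (S : set R)
    (M : lmodType R) : Prop :=
  forall N : set M, submodule N -> S_idempotent_submodule S N.

(* Main.v *)
Require Import Defs.
From HB Require Import structures.
From mathcomp Require Import all_boot all_order all_algebra.
From mathcomp Require Import boolp classical_sets.

Local Open Scope classical_set_scope.
Local Open Scope ring_scope.

Import GRing.Theory.

(** An idempotent N is S-idempotent with s = 1. Conversely, let rs = 1 and sN ⊆ (N:M)^2 M;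
    multiplying by r gives N ⊆ r(N:M)^2 M ⊆ (N:M)^2 M, where the last inclusion is
    [smul_setT_scale]. *)

(** The module factors range over all of M, so they absorb the scalar: r(ax) = a(rx) by
    commutativity of R. *)
Lemma smul_setT_scale (R : comPzRingType) (M : lmodType R) (I : set R)
    (r : R) (y : M) :
  smul I [set: M] y -> smul I [set: M] (r *: y).
Proof.
move=> [n [a [x [Ia [_ ->]]]]].
exists n, a, (fun i => r *: x i); split=> //; split=> //.
rewrite scaler_sumr; apply: eq_bigr => i _.
by rewrite !scalerA mulrC.
Qed.

Theorem proposition2p5 (R : comPzRingType) (S : set R) (hS : mult_closed S) :
  (forall M : lmodType R, fully_idempotent M -> fully_S_idempotent S M) /\
  (S `<=` units R ->
   forall M : lmodType R, fully_S_idempotent S M -> fully_idempotent M).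
Proof.
split=> [M idemM N subN | unitS M idemM N subN].
- have eqN : N = colon_sqr_mul N := idemM N subN.
  exists 1; split; first by case: hS => /set_mem.
  rewrite -eqN; split=> // _ [x Nx <-].
  by rewrite scale1r.
- have [s [Ss [sN_sub sub_N]]] := idemM N subN.
  have [r rs1] := unitS s Ss.
  apply/seteqP; split=> // x Nx.
  (* Here x becomes r(sx), and sx already lies in [colon_sqr_mul N]. *)
  rewrite -(scale1r x) -rs1 -scalerA.
  by apply: smul_setT_scale; apply: sN_sub; exists x.
Qed.
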